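(* Let $f^k_{k,n}$ and $l^i_{k,n}$ ($1\le i\le k$, $n\in\mathbb{Z}$) be as in the context. Then: (i) For $k\ge 3$, $1\le i\le k$ and $n\ge 0$, $$l^i_{k,n}=\sum_{j=1}^{k+i-1} d_j\, f^k_{k,n-j},\qquad d_j=\begin{cases}\frac{j(j+1)}{2} & \text{if } 1\le j\le i,\\ \frac{j(j+1)}{2}-\frac{(j-i)(j-i+1)}{2} & \text{if } i+1\le j\le k-1,\\ \frac{k(k+1)}{2}-\frac{(j-i)(j-i+1)}{2} & \text{if } k\le j\le k+i-1.\end{cases}$$ (ii) For $k\ge 2$, $1\le i\le k$ and $n\ge 0$, $$l^i_{k,n}=\begin{cases} kf^k_{k,n}-\sum_{j=2}^{k}(k-j+1)f^k_{k,n+1-j} & \text{if } i=1,\\ \sum_{m=1}^{i}kf^k_{k,n-m+1}-\sum_{m=1}^{i}\sum_{j=2}^{k}(k-j+1)f^k_{k,n-m-j+2} & \text{if } 1<i<k,\\ kf^k_{k,n+1}-\sum_{j=2}^{k}(k-j+1)f^k_{k,n+2-j} & \text{if } i=k.\end{cases}$$ (iii) For $k\ge 2$, $1\le i\le k$ and $n\ge 0$, $$l^i_{k,n}=\begin{cases} \sum_{j=1}^{k} j f^k_{k,n-j} & \text{if } i=1,\\ \sum_{m=1}^{i}\sum_{j=1}^{k} j f^k_{k,n-m-j+1} & \text{if } 1<i<k,\\ \sum_{j=1}^{k} jf^k_{k,n+1-j} & \text{if } i=k.\end{cases}$$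
   Context: $k$ sequences of generalized order-$k$ Fibonacci numbers: for $1\le i\le k$, $f^i_{k,n}=1$ if $1-k\le n\le 0$ and $i=1-n$, $f^i_{k,n}=0$ if $1-k\le n\le 0$ and $i\neq 1-n$, and $f^i_{k,n}=\sum_{j=1}^k f^i_{k,n-j}$ for $n\ge 1$. $k$ sequences of generalized order-$k$ Lucas numbers: for $1\le i\le k$ and $1-k\le n\le 0$, $l^i_{k,n}=-i$ if $i-n<k$, $l^i_{k,n}=i-2n$ if $i-n=k$, $l^i_{k,n}=k-i-1$ if $i-n>k$; and $l^i_{k,n}=\sum_{j=1}^k l^i_{k,n-j}$ for $n\ge 1$. All these sequences are extended to all integers $n$ by requiring their recurrence $x_n=\sum_{j=1}^k x_{n-j}$ to hold for all $n\in\mathbb{Z}$ (this determines the terms of index $<1-k$ uniquely). *)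

(* Defs.v *)
From HB Require Import structures.
From mathcomp Require Import all_boot all_order all_algebra.
From mathcomp Require Import zify.

Set Implicit Arguments.
Unset Strict Implicit.
Unset Printing Implicit Defensive.

Import Order.TTheory GRing.Theory Num.Theory.
Local Open Scope ring_scope.

(* The two-sided solution x : int -> int of x_n = x_(n-1) + ... + x_(n-k) with
   x_n = init n for 1 - k <= n <= 0.  A window w at time t stores x_(t-j) at
   position j; only the positions j < k are meaningful. *)

Definition window_next (k : nat) (w : nat -> int) : nat -> int :=
  fun j => if j is j'.+1 then w j' else \sum_(0 <= m < k) w m.

(* x_(t-k) = x_t - (x_(t-1) + ... + x_(t-k+1)) *)
Definition window_prev (k : nat) (w : nat -> int) : nat -> int :=
  fun j => if (j.+1 < k)%N then w j.+1 else w 0%N - \sum_(1 <= m < k) w m.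

Definition window (k : nat) (init : int -> int) (t : int) : nat -> int :=
  let w0 := fun j : nat => init (- j%:Z) in
  match t with
  | Posz m => iter m (window_next k) w0
  | Negz m => iter m.+1 (window_prev k) w0
  end.

Definition korder (k : nat) (init : int -> int) (n : int) : int :=
  window k init n 0%N.

(* f^i_{k,n} *)
Definition gfib (k i : nat) (n : int) : int :=
  korder k (fun m => if i%:Z == 1 - m then 1 else 0) n.

(* l^i_{k,n} *)
Definition gluc (k i : nat) (n : int) : int :=
  korder k (fun m =>
    if i%:Z - m < k%:Z then - i%:Z
    else if i%:Z - m == k%:Z then i%:Z - 2 * m
    else k%:Z - i%:Z - 1) n.

(* j (j + 1) / 2; the halving is exact *)
Definition triangular (j : nat) : int := ((j * j.+1)./2)%:Z.

(* d_j, for 1 <= j <= k + i - 1 *)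
Definition dcoef (k i j : nat) : int :=
  if (j <= i)%N then triangular j
  else if (j <= k.-1)%N then triangular j - triangular (j - i)
  else triangular k - triangular (j - i).

Lemma window_prevK k (k_gt0 : (0 < k)%N) (w : nat -> int) j :
  (j < k)%N -> window_next k (window_prev k w) j = w j.
Proof.
case: j => [_|j jk]; last by rewrite /= /window_prev jk.
rewrite /= -{1}(prednK k_gt0) big_nat_recr //= {2}/window_prev prednK // ltnn.
rewrite big_add1 /= (eq_big_nat _ _ (F2 := fun i => w i.+1)) => [|m mk].
  by rewrite addrC subrK.
by rewrite /window_prev ifT //; lia.
Qed.

Lemma windowS k init (k_gt0 : (0 < k)%N) t j : (j < k)%N ->
  window k init (t + 1) j = window_next k (window k init t) j.
Proof.
case: t => [m|[|m]] jk.
- by rewrite (_ : Posz m + 1 = Posz m.+1) //; lia.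
- by rewrite (_ : Negz 0 + 1 = 0) // window_prevK.
by rewrite (_ : Negz m.+1 + 1 = Negz m) ?[RHS]window_prevK //; lia.
Qed.

Lemma windowE k init (k_gt0 : (0 < k)%N) t j : (j < k)%N ->
  window k init t j = korder k init (t - j%:Z).
Proof.
elim: j t => [|j IHj] t jk; first by rewrite subr0.
rewrite -[t in LHS](subrK 1) windowS //= IHj; last lia.
by congr korder; lia.
Qed.

Lemma korder_init k init (k_gt0 : (0 < k)%N) n :
  1 - k%:Z <= n <= 0 -> korder k init n = init n.
Proof.
move=> hn; have hk : (`|n| < k)%N by lia.
have := windowE init k_gt0 0 hk; rewrite /= sub0r.
by have -> : - `|n|%N%:Z = n by lia.
Qed.

Lemma korder_rec k init (k_gt0 : (0 < k)%N) n :
  korder k init n = \sum_(1 <= j < k.+1) korder k init (n - j%:Z).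
Proof.
rewrite {1}/korder -[n in LHS](subrK 1) windowS //= big_add1 /=.
by apply: eq_big_nat => j /andP[_ jk]; rewrite windowE //; congr korder; lia.
Qed.

Lemma korder_unique k init (k_gt0 : (0 < k)%N) (x : int -> int) :
  (forall n, 1 - k%:Z <= n <= 0 -> x n = init n) ->
  (forall n, x n = \sum_(1 <= j < k.+1) x (n - j%:Z)) ->
  forall n, x n = korder k init n.
Proof.
move=> x0 xrec.
suff H t j : (j < k)%N -> window k init t j = x (t - j%:Z).
  by move=> n; rewrite /korder H // subr0.
have w0 i : (i < k)%N -> init (- i%:Z) = x (- i%:Z).
  by move=> ik; rewrite x0 //; lia.
case: t => m.
- elim: m j => [|m IHm] j jk; first by rewrite /= w0 // sub0r.
  rewrite /=; case: j jk => [_|j jk] /=.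
    rewrite subr0 xrec big_add1 /=; apply: eq_big_nat => i /andP[_ ik].
    by rewrite [LHS]IHm //; congr x; lia.
  by rewrite [LHS]IHm; [congr x; lia | lia].
have step (w : nat -> int) t :
    (forall i, (i < k)%N -> w i = x (t - i%:Z)) ->
    forall i, (i < k)%N -> window_prev k w i = x (t - 1 - i%:Z).
  move=> Hw i ik; rewrite /window_prev; case: ltnP => ki.
    by rewrite Hw //; congr x; lia.
  have -> : i = k.-1 by lia.
  rewrite Hw // subr0 [x t]xrec big_nat_recr //=.
  have -> : \sum_(1 <= m < k) w m = \sum_(1 <= m < k) x (t - m%:Z).
    by apply: eq_big_nat => a /andP[_ ak]; rewrite Hw.
  by rewrite addrAC subrr add0r; congr x; lia.
elim: m j => [|m IHm] j jk.
  have /(step _ 0) /(_ j jk) :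
      forall i, (i < k)%N -> init (- i%:Z) = x (0 - i%:Z).
    by move=> i ik; rewrite w0 // sub0r.
  by move=> e; rewrite [LHS]e; congr x; lia.
by rewrite [LHS](step _ _ IHm j jk); congr x; lia.
Qed.

(* Main.v *)
Require Import Defs.
From mathcomp Require Import all_boot all_order all_algebra.
From mathcomp Require Import zify ring.
Import Order.TTheory GRing.Theory Num.Theory.
Local Open Scope ring_scope.

(** Put [g = f^k_k] and [A n = \sum_(1 <= j <= k) j * g (n - j)].  The terms
    [g n] are explicit for [1 - 2k <= n <= 0], which gives [A = l^1] by comparing
    initial values.  In turn [l^1 n] is explicit for [2 - 2k <= n <= 0], and
    comparing initial values again gives
    [l^i n = l^1 n + l^1 (n - 1) + ... + l^1 (n - i + 1)]; for [i = k] the right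
    side is [l^1 (n + 1)] by the recurrence.  This is (iii).  Replacing [g n] by
    [\sum_(1 <= j <= k) g (n - j)] in (ii) gives (iii), and [d_j] is the
    coefficient of [g (n - j)] once the double sum in (iii) is expanded. *)

Ltac case_lia := repeat case: ifP; lia.

(** * Linearity of the recurrence and its continuation to lower indices *)

Definition order_rec (k : nat) (x : int -> int) : Prop :=
  forall n, x n = \sum_(1 <= j < k.+1) x (n - j%:Z).

(** The recurrence is linear and shift-invariant. This puts [fib_moment] and the sums of shifted
    [gluc k 1] within reach of [korder_unique]. *)
Lemma order_rec_sum (k a b : nat) (c h : nat -> int) (x : int -> int) :
  order_rec k x ->
  order_rec k (fun n => \sum_(a <= m < b) c m * x (n - h m)).
Proof.
move=> xrec n; rewrite exchange_big /=; apply: eq_bigr => m _.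
rewrite xrec mulr_sumr; apply: eq_bigr => j _.
by congr (_ * x _); lia.
Qed.

(** The recurrences at [n] and [n + 1] share all but their extreme terms, so subtracting them leaves
    three terms. *)
Lemma order_rec_back (k : nat) (x : int -> int) (n : int) :
  (0 < k)%N -> order_rec k x -> x (n - k%:Z) = 2 * x n - x (n + 1).
Proof.
move=> k_gt0 xrec.
have e1 : x (n + 1) = x n + \sum_(1 <= j < k) x (n - j%:Z).
  rewrite xrec big_nat_recl //=; congr (_ + _); first by congr x; lia.
  by apply: eq_bigr => j _; congr x; lia.
have e2 : x n = \sum_(1 <= j < k) x (n - j%:Z) + x (n - k%:Z).
  by rewrite {1}xrec big_nat_recr.
by lia.
Qed.

Lemma gfib_rec (k i : nat) : (0 < k)%N -> order_rec k (gfib k i).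
Proof. by move=> k_gt0 n; exact: korder_rec. Qed.

Lemma gluc_rec (k i : nat) : (0 < k)%N -> order_rec k (gluc k i).
Proof. by move=> k_gt0 n; exact: korder_rec. Qed.

(** * Explicit values of [gfib k k] *)

Lemma gfib_last_init (k : nat) (n : int) :
  (0 < k)%N -> 1 - k%:Z <= n <= 0 -> gfib k k n = if n == 1 - k%:Z then 1 else 0.
Proof.
move=> k_gt0 hn; rewrite /gfib korder_init //.
by case_lia.
Qed.

Lemma gfib_last1 (k : nat) : (0 < k)%N -> gfib k k 1 = 1.
Proof.
move=> k_gt0; rewrite gfib_rec // big_nat_recr //= big_nat big1 => [|j hj].
  by rewrite gfib_last_init //; case_lia.
by rewrite gfib_last_init //; case_lia.
Qed.

(** By [order_rec_back] at [n + k]: the value -1 is minus the term at 1, and 2 is twice the term at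
    [1 - k]. *)
Lemma gfib_last_back (k : nat) (n : int) : (2 <= k)%N ->
  1 - 2 * k%:Z <= n <= - k%:Z ->
  gfib k k n = if n == - k%:Z then -1 else if n == 1 - 2 * k%:Z then 2 else 0.
Proof.
move=> k_ge2 hn; have k_gt0 : (0 < k)%N by lia.
have -> : n = n + k%:Z - k%:Z by lia.
rewrite (@order_rec_back k _ _ k_gt0 (gfib_rec k k k_gt0)).
have [->|nk] := eqVneq n (- k%:Z).
  by rewrite addNr add0r gfib_last1 // gfib_last_init //; case_lia.
rewrite !gfib_last_init //; case_lia.
Qed.

(** * The sequence [A], here [fib_moment], and its identification with [gluc k 1] *)

Definition fib_moment (k : nat) (n : int) : int :=
  \sum_(1 <= j < k.+1) j%:Z * gfib k k (n - j%:Z).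

Lemma fib_moment_rec (k : nat) : (0 < k)%N -> order_rec k (fib_moment k).
Proof.
move=> k_gt0.
by apply: (@order_rec_sum k 1 k.+1 Posz Posz); exact: gfib_rec.
Qed.

(** Moving the argument down by one lowers each weight [j] to [j - 1], which costs one copy of the
    recurrence sum for [gfib k k n], and brings in one new term of weight [k]. *)
Lemma fib_moment_diff (k : nat) (n : int) : (0 < k)%N ->
  fib_moment k (n - 1) = fib_moment k n - gfib k k n + k%:Z * gfib k k (n - 1 - k%:Z).
Proof.
move=> k_gt0; rewrite [gfib k k n]gfib_rec // /fib_moment -sumrB.
have -> : \sum_(1 <= j < k.+1) (j%:Z * gfib k k (n - j%:Z) - gfib k k (n - j%:Z)) =
          \sum_(1 <= j < k.+1) (j%:Z - 1) * gfib k k (n - j%:Z).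
  by apply: eq_bigr => j _; ring.
rewrite [in RHS]big_nat_recl //= subrr mul0r add0r.
rewrite [LHS]big_nat_recr //=; congr (_ + _).
by apply: eq_bigr => j _; congr (_ * gfib k k _); lia.
Qed.

Lemma gluc1_init (k : nat) (n : int) : (0 < k)%N -> 1 - k%:Z <= n <= 0 ->
  gluc k 1 n = if n == 1 - k%:Z then 2 * k%:Z - 1 else -1.
Proof. by move=> k_gt0 hn; rewrite /gluc korder_init //; case_lia. Qed.

Lemma fib_moment_init (k t : nat) : (2 <= k)%N -> (t < k)%N ->
  fib_moment k (- t%:Z) = if t == k.-1 then 2 * k%:Z - 1 else -1.
Proof.
move=> k_ge2; have k_gt0 : (0 < k)%N by lia.
elim: t => [|t IHt] tk.
  (* At 0 only [j = k - 1] and [j = k] survive: (k - 1) - k = -1. *)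
  rewrite /fib_moment -{1}(prednK k_gt0) !big_nat_recr; try lia.
  rewrite big_nat big1 => [|j hj].
    rewrite gfib_last_init ?gfib_last_back /=; case_lia.
  by rewrite gfib_last_init; case_lia.
have -> : - t.+1%:Z = - t%:Z - 1 by lia.
rewrite fib_moment_diff // IHt; last lia.
(* Both correction terms vanish until the last step, [t = k - 2], where the value 2 at [1 - 2k] adds
   [2k]. *)
rewrite gfib_last_init ?gfib_last_back; case_lia.
Qed.

Lemma gluc1E (k : nat) (n : int) : (2 <= k)%N -> gluc k 1 n = fib_moment k n.
Proof.
move=> k_ge2; symmetry; apply: korder_unique => [|m hm|]; first by lia.
  have -> : m = - `|m|%N%:Z by lia.
  by rewrite fib_moment_init; case_lia.
by apply: fib_moment_rec; lia.
Qed.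

(** * Each [gluc k i] as a sum of shifts of [gluc k 1] *)

Lemma gluc1_1 (k : nat) : (0 < k)%N -> gluc k 1 1 = k%:Z.
Proof.
move=> k_gt0; rewrite gluc_rec // big_nat_recr //=.
rewrite (eq_big_nat _ _ (F2 := fun=> -1)) => [|j hj].
  by rewrite sumr_const_nat gluc1_init //; case_lia.
by rewrite gluc1_init //; case_lia.
Qed.

Lemma gluc1_back (k : nat) (n : int) : (2 <= k)%N ->
  2 - 2 * k%:Z <= n <= - k%:Z ->
  gluc k 1 n = if n == - k%:Z then - k%:Z - 2 else -1.
Proof.
move=> k_ge2 hn; have k_gt0 : (0 < k)%N by lia.
have -> : n = n + k%:Z - k%:Z by lia.
rewrite (@order_rec_back k _ _ k_gt0 (gluc_rec k 1 k_gt0)).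
have [->|nk] := eqVneq n (- k%:Z).
  by rewrite addNr add0r gluc1_1 // gluc1_init //; case_lia.
by rewrite !gluc1_init //; case_lia.
Qed.

(** The cases tell whether the lowest index [n - i + 1] lies above, at or below [1 - k]. Terms equal
    -1 except [2k - 1] at [1 - k] and [- k - 2] at [- k]. *)
Lemma sum_gluc1_init (k i : nat) (n : int) : (2 <= k)%N -> (i <= k)%N ->
  1 - k%:Z <= n <= 0 ->
  \sum_(0 <= m < i) gluc k 1 (n - m%:Z) =
    if i%:Z - n < k%:Z then - i%:Z
    else if i%:Z - n == k%:Z then i%:Z - 2 * n
    else k%:Z - i%:Z - 1.
Proof.
move=> k_ge2 + hn; elim: i => [|i IHi] ik.
  by rewrite big_geq // ifT //; case_lia.
rewrite big_nat_recr //= IHi; last lia.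
have [hb|hb] := boolP (n - i%:Z <= - k%:Z).
  by rewrite gluc1_back //; case_lia.
by rewrite gluc1_init //; case_lia.
Qed.

Lemma gluc_sum_gluc1 (k i : nat) (n : int) : (2 <= k)%N -> (i <= k)%N ->
  gluc k i n = \sum_(0 <= m < i) gluc k 1 (n - m%:Z).
Proof.
move=> k_ge2 ik; symmetry.
apply: (@korder_unique k _ _ (fun n => \sum_(0 <= m < i) gluc k 1 (n - m%:Z))).
- by lia.
- by move=> m hm; exact: sum_gluc1_init.
have k_gt0 : (0 < k)%N by lia.
move=> m; have := @order_rec_sum k 0 i (fun=> 1) Posz _ (gluc_rec k 1 k_gt0) m.
by under eq_bigr do rewrite mul1r; under [in RHS]eq_bigr do
  under eq_bigr do rewrite mul1r.
Qed.

Lemma gluc_last (k : nat) (n : int) : (2 <= k)%N ->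
  gluc k k n = gluc k 1 (n + 1).
Proof.
move=> k_ge2; rewrite gluc_sum_gluc1 // [RHS]gluc_rec; last lia.
by rewrite big_add1 /=; apply: eq_bigr => m _; congr gluc; lia.
Qed.

Lemma fib_momentE (k : nat) (n : int) : (0 < k)%N ->
  fib_moment k n =
    k%:Z * gfib k k n
    - \sum_(2 <= j < k.+1) (k%:Z - j%:Z + 1) * gfib k k (n + 1 - j%:Z).
Proof.
move=> k_gt0; rewrite big_add1 /=.
(* The added term [j = k] has coefficient 0, so both sums get the same range. *)
have -> : \sum_(1 <= j < k) (k%:Z - j.+1%:Z + 1) * gfib k k (n + 1 - j.+1%:Z) =
          \sum_(1 <= j < k.+1) (k%:Z - j%:Z) * gfib k k (n - j%:Z).
  rewrite [RHS]big_nat_recr //= subrr mul0r addr0; apply: eq_bigr => j _.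
  by congr (_ * gfib k k _); lia.
rewrite [gfib k k n]gfib_rec // mulr_sumr -sumrB; apply: eq_bigr => j _.
by ring.
Qed.

(** * The coefficients [dcoef] *)

Lemma triangularS (j : nat) : triangular j.+1 = triangular j + j.+1%:Z.
Proof.
rewrite /triangular; have -> : (j.+1 * j.+2 = j * j.+1 + j.+1.*2)%N by lia.
by rewrite halfD odd_double andbF doubleK add0n PoszD.
Qed.

(** The increment [j - i] is a difference of consecutive triangular numbers; it is the weight of
    [x (n - j)] in the row [m = i] of the double sum. *)
Lemma dcoefS (k i j : nat) : (i < k)%N ->
  dcoef k i.+1 j = dcoef k i j + (if (i < j)%N then j%:Z - i%:Z else 0).
Proof.
move=> ik; rewrite /dcoef; case: (ltnP i j) => ij; last by rewrite ltnW // addr0.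
have e : triangular (j - i) = triangular (j - i.+1) + (j%:Z - i%:Z).
  by rewrite -subSS subSn // triangularS; lia.
(* Only [j = i + 1] moves to another branch of [dcoef]. *)
rewrite [in LHS]leq_eqVlt; have [->|nj] := eqVneq j i.+1.
  have -> : triangular (i.+1 - i) = 1 by rewrite subSn ?subnn.
  rewrite /=; case: ifP => [_|ki]; first by lia.
  by have -> : k = i.+1; lia.
by rewrite /= ltnNge ij /=; case: ifP => _; lia.
Qed.

Lemma sum_dcoef (k i : nat) (x : int -> int) (n : int) : (0 < k)%N -> (i <= k)%N ->
  \sum_(1 <= j < k + i) dcoef k i j * x (n - j%:Z) =
  \sum_(0 <= m < i) \sum_(1 <= j < k.+1) j%:Z * x (n - m%:Z - j%:Z).
Proof.
move=> k_gt0; elim: i => [|i IHi] ik.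
  rewrite [RHS]big_geq // big_nat big1 // => j hj.
  rewrite /dcoef subn0 leqNgt ifF; last lia.
  by rewrite ifT ?subrr ?mul0r //; lia.
rewrite [RHS]big_nat_recr //= -IHi; last lia.
under eq_bigr do rewrite dcoefS // mulrDl.
rewrite big_split /=; congr (_ + _).
  (* The range gains [j = k + i], where [dcoef k i] is 0. *)
  rewrite addnS big_nat_recr /=; last lia.
  suff -> : dcoef k i (k + i) = 0 by rewrite mul0r addr0.
  rewrite /dcoef addnK subrr; case: ifP => [|_]; first by lia.
  by rewrite ifF //; lia.
(* The increments vanish for [j <= i]; shifting the others by [i] gives the row [m = i]. *)
rewrite (big_cat_nat (n := i.+1)) /=; try lia.
rewrite big_nat big1 ?add0r => [|j hj]; last by rewrite ifF ?mul0r //; lia.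
rewrite -[i.+1 in LHS]add1n big_addn.
have -> : (k + i.+1 - i = k.+1)%N by lia.
rewrite big_nat [RHS]big_nat; apply: eq_bigr => j hj.
by rewrite ifT; [congr (_ * x _); lia | lia].
Qed.

Lemma gluc_sum_moment (k i : nat) (n : int) : (2 <= k)%N -> (i <= k)%N ->
  gluc k i n = \sum_(0 <= m < i) fib_moment k (n - m%:Z).
Proof.
move=> k_ge2 ik; rewrite gluc_sum_gluc1 //.
by apply: eq_bigr => m _; exact: gluc1E.
Qed.

Theorem theorem2p10 :
  (forall (k i : nat) (n : int), (3 <= k)%N -> (1 <= i <= k)%N -> 0 <= n ->
     gluc k i n = \sum_(1 <= j < k + i) dcoef k i j * gfib k k (n - j%:Z))
  /\
  (forall (k i : nat) (n : int), (2 <= k)%N -> (1 <= i <= k)%N -> 0 <= n ->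
     gluc k i n =
       if i == 1%N then
         k%:Z * gfib k k n
         - \sum_(2 <= j < k.+1) (k%:Z - j%:Z + 1) * gfib k k (n + 1 - j%:Z)
       else if (i < k)%N then
         \sum_(1 <= m < i.+1) k%:Z * gfib k k (n - m%:Z + 1)
         - \sum_(1 <= m < i.+1) \sum_(2 <= j < k.+1)
             (k%:Z - j%:Z + 1) * gfib k k (n - m%:Z - j%:Z + 2)
       else
         k%:Z * gfib k k (n + 1)
         - \sum_(2 <= j < k.+1) (k%:Z - j%:Z + 1) * gfib k k (n + 2 - j%:Z))
  /\
  (forall (k i : nat) (n : int), (2 <= k)%N -> (1 <= i <= k)%N -> 0 <= n ->
     gluc k i n =
       if i == 1%N then
         \sum_(1 <= j < k.+1) j%:Z * gfib k k (n - j%:Z)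
       else if (i < k)%N then
         \sum_(1 <= m < i.+1) \sum_(1 <= j < k.+1)
           j%:Z * gfib k k (n - m%:Z - j%:Z + 1)
       else
         \sum_(1 <= j < k.+1) j%:Z * gfib k k (n + 1 - j%:Z)).
Proof.
split; [|split] => k i n k_ge /andP[i_gt0 ik] _.
- rewrite gluc_sum_moment ?sum_dcoef //; lia.
- case: eqP => [->|_]; first by rewrite gluc1E // fib_momentE //; lia.
  case: ltnP => [_|ki].
    rewrite gluc_sum_moment // -sumrB [RHS]big_add1 /=.
    apply: eq_bigr => m _; rewrite fib_momentE; last lia.
    congr (_ * gfib k k _ - _); first by lia.
    by apply: eq_bigr => j _; congr (_ * gfib k k _); lia.
  have -> : i = k by lia.
  rewrite gluc_last // gluc1E // fib_momentE; last lia.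
  by congr (_ - _); apply: eq_bigr => j _; congr (_ * gfib k k _); lia.
- case: eqP => [->|_]; first exact: gluc1E.
  case: ltnP => [_|ki].
    rewrite gluc_sum_moment // [RHS]big_add1 /=.
    apply: eq_bigr => m _; apply: eq_bigr => j _.
    by congr (_ * gfib k k _); lia.
  have -> : i = k by lia.
  by rewrite gluc_last // gluc1E.
Qed.
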